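(* Let $\mathcal{A}$ be a proper pattern avoidance class, and for each $n$ let $\Pi_n$ be a uniformly random element of $\mathcal{S}_n$. Let $\alpha > 1/3$ and $\beta < \min(\alpha, 3\alpha-1)$ be real numbers. Then, for all sufficiently large $n$, $$\mathbf{Pr}\left( \left| L_{\mathcal{A}}(\Pi_n) - \mathbf{E}\, L_{\mathcal{A}}(\Pi_n)\right| \geq n^{\alpha}\right) < \exp(-n^{\beta}).$$
   Context: $\mathcal{S}_n$ is the set of permutations of $\{1,\dots,n\}$, written as sequences. The pattern of a finite sequence of distinct elements of a linearly ordered set is the permutation whose entries are in the same relative order as those of the sequence. A permutation $\sigma$ occurs as a pattern in (is involved in) $\pi$ if some subsequence of $\pi$ (not necessarily contiguous) has pattern $\sigma$; otherwise $\pi$ avoids $\sigma$. For a set $B$ of permutations, $\mathrm{Av}(B)$ is the set of all permutations avoiding every element of $B$; a pattern avoidance class is a set of the form $\mathrm{Av}(B)$. It is proper if it is not the set of all permutations, i.e. $B$ is non-empty. The elements of $B$ are taken to have length at least $1$, and the empty permutation is regarded as belonging to every class, so that longest subsequences always exist. For a permutation $\pi$, $L_{\mathcal{A}}(\pi)$ is the maximum length of a subsequence of $\pi$ whose pattern belongs to $\mathcal{A}$. *)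

(* Defs.v *)
From mathcomp Require Import all_boot all_order all_fingroup all_algebra.
From mathcomp Require Import all_classical all_reals all_analysis.

Set Implicit Arguments.
Unset Strict Implicit.
Unset Printing Implicit Defensive.

Local Open Scope classical_set_scope.
Local Open Scope ring_scope.

(* Permutations of arbitrary finite length, the empty one included; a
   permutation of length n permutes {0, ..., n-1} rather than {1, ..., n}. *)
Definition permutation := {n : nat & 'S_n}.

Definition plength (p : permutation) : nat := tag p.

Definition word (p : permutation) : seq nat :=
  [seq val (tagged p i) | i <- enum 'I_(plength p)].

(* The equivalence, for a permutation q, forces the entries of s to be
   pairwise distinct. *)
Definition has_pattern (s : seq nat) (q : permutation) : bool :=
  (size s == plength q) &&
  [forall i : 'I_(plength q), forall j : 'I_(plength q),
     (nth 0%N s i < nth 0%N s j)%N == (tagged q i < tagged q j)%N].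

Definition involved (q p : permutation) : Prop :=
  exists2 s : seq nat, subseq s (word p) & has_pattern s q.

Definition Av (B : set permutation) : set permutation :=
  [set p | forall q, B q -> ~ involved q p].

Definition avoidance_class (A : set permutation) : Prop :=
  exists2 B : set permutation,
    (forall q, B q -> (1 <= plength q)%N) & A = Av B.

(* The subsequences of s are the sequences mask m s, with m a vector of
   booleans of length size s. *)
Definition longest (A : set permutation) (p : permutation) : nat :=
  (\max_(m : (plength p).-tuple bool
         | `[< exists2 q, A q & has_pattern (mask m (word p)) q >])
     size (mask m (word p)))%N.

(* The event {X = s} is required to be measurable for every s. *)
Definition uniform_perm (R : realType) (d : measure_display)
    (T : measurableType d) (P : probability T R) (n : nat)
    (X : T -> 'S_n) : Prop :=
  forall s : 'S_n,
    measurable (X @^-1` [set s]) /\ P (X @^-1` [set s]) = ((n`!%:R)^-1)%:E.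

(* Main.v *)
Require Import Defs.
From mathcomp Require Import all_boot all_order all_fingroup all_algebra.
From mathcomp Require Import all_classical all_reals all_analysis.
From mathcomp Require Import ring lra zify.

Import Order.TTheory GRing.Theory Num.Theory.
Import numFieldNormedType.Exports.

(** Write [A = Av B]; since [A] is proper, [B] contains some permutation [q] of
length [k >= 1].  The proof compares the random permutation with a random word
[x] whose [n] letters are independent and uniform in ['I_N].  Only the
relative order of the letters matters: the largest set of positions on which
[x] is injective and avoids [B] ([largest (admissible_word B)]) plays the role
of the longest subsequence, and agrees with it when [x] is injective
([longest_Av], [largest_comp_perm]).  Given that [x] is injective, its relative
order is a uniform permutation; and for [N >= 2 n ^ 2] the word is injective
with probability at least 1/2.  Hence the average of a nonnegative function of
the longest subsequence at most doubles when passing from words to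
permutations ([avg_longest_le]).

Two facts about words give the theorem.

Concentration.  Let [f] be the largest cardinal of an admissible set and [f_i]
the same quantity with position [i] forbidden.  Then [0 <= f - f_i <= 1], and
the [f - f_i] have sum at most [f], because deleting a position outside an
optimal set costs nothing.  For such a self-bounding [f], reveal the letters
one at a time.  When [m] letters are hidden, some hidden position has expected
influence at most [1/m] times the conditional mean of [f]; revealing that one
moves the conditional mean by at most 1, with a conditional variance at most
this expected influence.  Summing [1/m] over all steps yields
[E exp(l f) <= exp((l + 4 l^2 H) mu)], where [mu = E f] and [H] is the [n]-th
harmonic number, for [l] of either sign with [|l| <= 1/6] and [4 |l| H <= 1]
([self_bounding_mgf], [largest_mgf]).  The factor [H] is of logarithmic size
and is absorbed by the slack in the exponents.

Size of the mean.  Cut the positions and the values into [m] intervals each,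
with [m] of order [sqrt n].  The cells met by an admissible set form a 0-1
matrix avoiding [q], so by the Marcus-Tardos theorem ([marcus_tardos]) there
are [O(m)] of them.  The number of points of [x] in a given cell has a bounded
exponential moment, so cells with many more than [ln m] points contribute
little in mean: [mu = O(m ln m)] ([avg_largest_admissible_le]).

Jensen's inequality applied to [- l] recentres the exponential bound at the
mean over permutations, whence
[Pr(|L - E L| >= t) <= 8 exp(8 l^2 H mu - l t)] ([longest_tail]).  With
[t = n^alpha] and [l = n^(gamma - alpha)], where [gamma] lies between
[max(beta, 0)] and [min(alpha, 3 alpha - 1)], the main term is [- n^gamma], and
[8 l^2 H mu] is of smaller order since
[gamma < (alpha + (3 alpha - 1)) / 2 = 2 alpha - 1/2]
([avg_longest_tail_near]). *)

Set Implicit Arguments.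
Unset Strict Implicit.
Unset Printing Implicit Defensive.

(** * Increasing maps between initial segments *)

Lemma sorted_enum_set n (S : {set 'I_n}) :
  sorted (fun a b : 'I_n => a < b) (enum S).
Proof.
rewrite -(@sorted_map _ _ val ltn).
apply: (subseq_sorted ltn_trans (map_subseq _ _) _); first exact: filter_subseq.
by rewrite -enumT val_enum_ord iota_ltn_sorted.
Qed.

Lemma ltn_ord_trans n : transitive (fun a b : 'I_n => a < b).
Proof. by move=> b a c; apply: ltn_trans. Qed.

Lemma enum_val_lt n (S : {set 'I_n}) (i j : 'I_#|S|) :
  i < j -> enum_val i < enum_val j.
Proof.
move=> ij; have [x0 _] : exists x0 : 'I_n, true by exists (enum_val i).
rewrite !(enum_val_nth x0).
by apply: (sorted_ltn_nth (@ltn_ord_trans n) _ (sorted_enum_set S));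
  rewrite ?inE -?cardE.
Qed.

Lemma increasing_lt k n (g : 'I_k -> 'I_n) :
  (forall i j : 'I_k, i < j -> g i < g j) -> forall i j, (g i < g j) = (i < j).
Proof.
move=> gP i j; case: (ltngtP i j) => [/gP //|/gP ji|/val_inj ->].
- by apply/negbTE; rewrite -leqNgt ltnW.
- by rewrite ltnn.
Qed.

Lemma increasing_in_set n k (S : {set 'I_n}) : k <= #|S| ->
  exists2 g : 'I_k -> 'I_n, (forall i, g i \in S)
    & (forall i j : 'I_k, i < j -> g i < g j).
Proof.
move=> kS; exists (fun i => enum_val (widen_ord kS i)) => [i|i j ij].
  exact: enum_valP.
exact: enum_val_lt.
Qed.

(** * The Marcus-Tardos theorem *)

(** Occurrence of the permutation matrix of [sigma] as a submatrix of the
infinite 0-1 matrix [e], up to replacing ones by zeros.  Two implications on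
the coordinates suffice, since the orders on ['I_k] are total. *)
Definition occurs (k : nat) (sigma : 'S_k) (e : nat -> nat -> bool) : Prop :=
  exists gx gy : 'I_k -> nat,
    [/\ forall i, e (gx i) (gy i),
        forall i j : 'I_k, i < j -> gx i < gx j
      & forall i j : 'I_k, sigma i < sigma j -> gy i < gy j].

Definition entries (m : nat) (e : nat -> nat -> bool) : nat :=
  \sum_(x < m) \sum_(y < m) e x y.

(** Transposing a permutation matrix inverts the permutation; this reduces
statements about tall blocks to statements about wide ones. *)
Lemma occurs_transpose k (sigma : 'S_k) e :
  occurs sigma^-1 (fun x y => e y x) -> occurs sigma e.
Proof.
case=> gx [gy [he hx hy]].
exists (gy \o sigma), (gx \o sigma); split=> [i|i j ij|i j ij] /=.
- exact: he.
- by apply: hy; rewrite !permK.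
- exact: hx.
Qed.

(** The projection on the first coordinate of the block of side [s] with
indices [a] and [b]. *)
Definition row_shape (s a b : nat) (e : nat -> nat -> bool) : {set 'I_s} :=
  [set r : 'I_s | [exists r' : 'I_s, e (a * s + r) (b * s + r')]].

Definition contraction (s : nat) (e : nat -> nat -> bool) (a b : nat) : bool :=
  [exists r : 'I_s, exists r' : 'I_s, e (a * s + r) (b * s + r')].

(** One entry chosen in each block of an occurrence in the contraction gives an
occurrence in the matrix, because entries of distinct block rows or columns
are ordered like their blocks. *)
Lemma occurs_contraction k (sigma : 'S_k) s e :
  occurs sigma (contraction s e) -> occurs sigma e.
Proof.
have lt_block u v (r r' : 'I_s) : u < v -> u * s + r < v * s + r'.
  by move=> uv; have := ltn_ord r; nia.
case=> gx [gy [he hx hy]].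
have /fin_all_exists[r hr] i : exists r : 'I_s, [exists r' : 'I_s,
  e (gx i * s + r) (gy i * s + r')] by apply/existsP/he.
have /fin_all_exists[r' hr'] i : exists r' : 'I_s,
  e (gx i * s + r i) (gy i * s + r') by apply/existsP/hr.
exists (fun i => gx i * s + r i), (fun i => gy i * s + r' i).
by split=> // i j ij; apply: lt_block; auto.
Qed.

(** Pigeonhole on the [2 ^ s] possible projections: if [k] blocks with the same
first index share a projection having at least [k] elements, then the [i]-th
of these elements can be taken in the [sigma i]-th block, and [sigma]
occurs. *)
Lemma wide_blocks k (sigma : 'S_k) s t a e : ~ occurs sigma e ->
  \sum_(b < t) (k <= #|row_shape s a b e|) <= k * 2 ^ s.
Proof.
move=> av.
have shape_le (X : {set 'I_s}) :
    \sum_(b < t | row_shape s a b e == X) (k <= #|X|) <= k.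
  case: (leqP k #|X|) => [kX|_]; last by rewrite big1.
  (* k blocks with projection X would give an occurrence of sigma *)
  rewrite sum1dep_card; apply/ltnW; rewrite ltnNge; apply/negP.
  move=> /increasing_in_set[bs bsP bs_lt].
  have [xs xsP xs_lt] := increasing_in_set kX.
  apply: av.
  have /fin_all_exists[r hr] i : exists r : 'I_s,
      e (a * s + xs i) (bs (sigma i) * s + r).
    have shX : row_shape s a (bs (sigma i)) e = X.
      by have := bsP (sigma i); rewrite inE => /eqP.
    by have := xsP i; rewrite -shX inE => /existsP.
  exists (fun i => a * s + xs i), (fun i => bs (sigma i) * s + r i).
  split=> // i j ij; first by rewrite ltn_add2l xs_lt.
  by have := bs_lt _ _ ij; have := ltn_ord (r i); nia.
rewrite (partition_big (fun b : 'I_t => row_shape s a b e) xpredT) //=.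
apply: (@leq_trans (\sum_(X : {set 'I_s}) k)); last first.
  by rewrite sum_nat_const -cardsT -powersetT card_powerset cardsT card_ord mulnC.
apply: leq_sum => X _; rewrite (eq_bigr (fun=> (k <= #|X|) : nat)) //.
by move=> b /eqP ->.
Qed.

Lemma sum_blocks (t s : nat) (F : nat -> nat) :
  \sum_(x < t * s) F x = \sum_(a < t) \sum_(r < s) F (a * s + r).
Proof.
elim: t => [|t IH]; first by rewrite !big_ord0.
by rewrite big_ord_recr -IH mulSnr big_split_ord.
Qed.

Lemma entries_blocks t s e : entries (t * s) e = \sum_(a < t) \sum_(b < t)
  \sum_(r < s) \sum_(r' < s) e (a * s + r) (b * s + r').
Proof.
rewrite /entries (sum_blocks t s (fun x => \sum_(y < t * s) e x y)).
apply: eq_bigr => a _; rewrite [RHS]exchange_big /=; apply: eq_bigr => r _.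
by rewrite (sum_blocks t s (fun y => e _ y)).
Qed.

(** A nonempty block that is neither wide nor tall has fewer than [k ^ 2]
entries; the others have at most [s ^ 2] and are few by [wide_blocks], applied
to [e] and to its transpose. *)
Lemma entries_contraction k (sigma : 'S_k) s t e : ~ occurs sigma e ->
  entries (t * s) e <=
    k ^ 2 * entries t (contraction s e) + 2 * t * (k * 2 ^ s) * s ^ 2.
Proof.
move=> av; pose eT x y := e y x.
have avT : ~ occurs sigma^-1 eT by move/occurs_transpose.
pose wide a b := k <= #|row_shape s a b e|.
pose tall a b := k <= #|row_shape s b a eT|.
have block_le (a b : nat) :
    \sum_(r < s) \sum_(r' < s) e (a * s + r) (b * s + r') <=
    k ^ 2 * contraction s e a b + wide a b * s ^ 2 + tall a b * s ^ 2.
  have prod_le : \sum_(r < s) \sum_(r' < s) e (a * s + r) (b * s + r') <=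
      #|row_shape s a b e| * #|row_shape s b a eT|.
    rewrite pair_big /= -cardsX -sum1_card.
    rewrite [leqRHS]big_mkcond leq_sum // => -[r r'] _ /=.
    case E: (e _ _) => //; rewrite !inE /=.
    have -> : [exists r' : 'I_s, e (a * s + r) (b * s + r')].
      by apply/existsP; exists r'.
    suff -> : [exists r : 'I_s, eT (b * s + r') (a * s + r)] by [].
    by apply/existsP; exists r.
  have s_le (X : {set 'I_s}) : #|X| <= s by rewrite -[leqRHS]card_ord max_card.
  case: (boolP (contraction s e a b)) => [_|no]; last first.
    rewrite big1 // => r _; rewrite big1 // => r' _; case E: (e _ _) => //.
    by case/existsP: no; exists r; apply/existsP; exists r'.
  apply: (leq_trans prod_le); rewrite muln1 /wide /tall.
  have := s_le (row_shape s a b e); have := s_le (row_shape s b a eT).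
  by case: (leqP k _) => ?; case: (leqP k _) => ?; nia.
rewrite entries_blocks; apply: (@leq_trans (\sum_(a < t) \sum_(b < t)
    (k ^ 2 * contraction s e a b + wide a b * s ^ 2 + tall a b * s ^ 2))).
  by apply: leq_sum => a _; apply: leq_sum => b _.
under eq_bigr do rewrite 2!big_split /=.
rewrite 2!big_split /= -addnA /entries; apply: leq_add.
  by rewrite big_distrr leq_sum //= => a _; rewrite big_distrr.
have -> : 2 * t * (k * 2 ^ s) * s ^ 2 =
  t * (k * 2 ^ s * s ^ 2) + t * (k * 2 ^ s * s ^ 2) by nia.
rewrite -[X in X * (k * _ * _)](card_ord t) -sum_nat_const.
apply: leq_add; last rewrite exchange_big /=; apply: leq_sum => a _;
  rewrite -big_distrl /= leq_mul2r; apply/orP; right.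
- exact: wide_blocks av.
- exact: wide_blocks avT.
Qed.

(** The side of the blocks is chosen larger than the coefficient [k ^ 2] in
[entries_contraction], so that the recursion solves to a linear bound.  Powers
of this side suffice for a grid whose size matters only up to a constant
factor. *)
Theorem marcus_tardos k (sigma : 'S_k) : exists C, forall j e,
  ~ occurs sigma e ->
  entries ((k.+1 ^ 2) ^ j) e <= C * (k.+1 ^ 2) ^ j.
Proof.
set s := k.+1 ^ 2; set D := 2 * (k * 2 ^ s) * s ^ 2.
exists D.+1; elim=> [|j IH] e av.
  by rewrite expn0 /entries !big_ord1; case: (e _ _).
have {}IH := IH _ (fun h => av (occurs_contraction h)).
rewrite expnSr; apply: (leq_trans (entries_contraction _ _ av)).
have -> : 2 * s ^ j * (k * 2 ^ s) * s ^ 2 = D * s ^ j by rewrite /D; ring.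
apply: (@leq_trans (k ^ 2 * (D.+1 * s ^ j) + D * s ^ j)).
  by rewrite leq_add2r leq_mul2l IH orbT.
have ks : k ^ 2 + 1 <= s by rewrite /s; nia.
rewrite [leqRHS]mulnA; apply: leq_trans (leq_mul (leqnn (D.+1 * s ^ j)) ks).
by rewrite mulnDr muln1 [k ^ 2 * _]mulnC leq_add2l leq_mul2r leqnSn orbT.
Qed.

(** * Longest subsequences as largest admissible sets of positions *)

Definition occurs_in n (x : 'I_n -> nat) (S : {set 'I_n}) (q : permutation) :=
  exists g : 'I_(plength q) -> 'I_n,
    [/\ forall i, g i \in S,
        forall i j : 'I_(plength q), i < j -> g i < g j
      & forall i j, (x (g i) < x (g j)) = (tagged q i < tagged q j)].

(** Subsequences are handled through the increasing embeddings of their sets of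
positions, for which composition and restriction are immediate. *)
Lemma occurs_inP n (x : 'I_n -> nat) (S : {set 'I_n}) q :
  (exists2 t, subseq t [seq x i | i <- enum S] & has_pattern t q) <->
  occurs_in x S q.
Proof.
split=> [[t /subseqP[m _ ->]]|[g [gS g_lt gx]]].
  rewrite -map_mask; set u := mask m (enum S) => /andP[].
  rewrite size_map => sz /forallP pat.
  have su : subseq u (enum S) by exact: mask_subseq.
  have srt := subseq_sorted (@ltn_ord_trans n) su (sorted_enum_set S).
  exists (tnth (Tuple sz)); split=> [i|i j ij|i j].
  - by rewrite -mem_enum (mem_subseq su) // mem_tnth.
  - have x0 := tnth (Tuple sz) i; rewrite !(tnth_nth x0) /=.
    by apply: (sorted_ltn_nth (@ltn_ord_trans n) _ srt);
      rewrite ?inE ?(eqP sz).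
  - have /forallP/(_ j)/eqP <- := pat i.
    have x0 := tnth (Tuple sz) i; rewrite !(tnth_nth x0) /=.
    by rewrite !(nth_map x0) // (eqP sz).
pose u := [seq g i | i <- enum 'I_(plength q)].
have srt : sorted (fun a b : 'I_n => a < b) u.
  apply: (homo_sorted (e := fun a b : 'I__ => a < b)); first by move=> i j; exact: g_lt.
  by rewrite -(@sorted_map _ _ val ltn) val_enum_ord iota_ltn_sorted.
exists (map x u).
  apply: map_subseq; suff -> : u = [seq i <- enum S | i \in u] by exact: filter_subseq.
  apply: (irr_sorted_eq (@ltn_ord_trans n) _ srt); first by move=> i; exact: ltnn.
    exact: (sorted_filter (@ltn_ord_trans n) _ (sorted_enum_set S)).
  move=> i; rewrite mem_filter mem_enum andb_idr // => /mapP[j _ ->].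
  exact: gS.
apply/andP; split; first by rewrite 2!size_map -cardE card_ord.
have nthE (a : 'I_(plength q)) : nth 0 (map x u) a = x (g a).
  have sz : size (enum 'I_(plength q)) = plength q by rewrite -cardE card_ord.
  have su : size u = plength q by rewrite size_map sz.
  by rewrite (nth_map (g a)) ?su // /u (nth_map a) ?sz // nth_ord_enum.
by apply/forallP => i; apply/forallP => j; rewrite !nthE gx eqxx.
Qed.

(** The rank of an entry, that is the number of smaller entries, is the value of
the pattern. *)
Lemma standardize k (y : 'I_k -> nat) : injective y ->
  exists q : 'S_k, forall i j, (q i < q j) = (y i < y j).
Proof.
move=> y_inj; pose below i := [set j | y j < y i]%SET.
have below_lt i : #|below i| < k.
  rewrite -[ltnRHS]card_ord -cardsT proper_card //.
  by apply/properP; split; [exact: finset.subsetT|exists i; rewrite !inE ?ltnn].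
have rank_lt i j : (#|below i| < #|below j|) = (y i < y j).
  have sub (a b : 'I_k) : y a <= y b -> below a \subset below b.
    by move=> ab; apply/fintype.subsetP => c; rewrite !inE => /leq_trans; apply.
  apply/idP/idP => [|ij].
    by apply: contraTT; rewrite -!leqNgt => /sub/subset_leq_card.
  apply/proper_card/properP; split; first exact/sub/ltnW.
  by exists i; rewrite !inE ?ltnn.
pose rank i : 'I_k := Ordinal (below_lt i).
have rank_inj : injective rank.
  move=> i j [ij]; apply: y_inj; apply/eqP; rewrite -[_ == _]negbK neq_ltn.
  by rewrite -(rank_lt i j) -(rank_lt j i) ij ltnn.
by exists (perm rank_inj) => i j; rewrite !permE rank_lt.
Qed.

(** A condition on the order of the entries alone that says that the
subsequence at positions [S] has a pattern in [Av B].  Repeated letters are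
excluded because they have no pattern. *)
Definition admissible (B : set permutation) n (x : 'I_n -> nat)
    (S : {set 'I_n}) : Prop :=
  {in S &, injective x} /\ forall q, B q -> ~ occurs_in x S q.

Lemma involvedE q n (p : 'S_n) :
  involved q (existT _ n p) <-> occurs_in (fun i => p i) (finset.setT) q.
Proof. by rewrite -occurs_inP enum_setT -enumT. Qed.

(** From left to right, an occurrence of [s] among the positions [S] factors
through the embedding of [q], whose image is all of [S] by cardinality.  From
right to left, the pattern is the standardization of the subsequence. *)
Lemma admissibleP B n (x : 'I_n -> nat) (S : {set 'I_n}) :
  (exists2 q, Av B q & has_pattern [seq x i | i <- enum S] q) <->
  admissible B x S.
Proof.
split=> [[[k q] avq pat]|[x_inj avB]].
  have [g [gS g_lt gx]] : occurs_in x S (existT _ k q).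
    by apply/occurs_inP; exists [seq x i | i <- enum S].
  have g_inj : injective g.
    move=> i j gij; apply/val_inj/eqP; rewrite -[_ == _]negbK neq_ltn.
    by rewrite -(increasing_lt g_lt i j) -(increasing_lt g_lt j i) gij ltnn.
  have gsurj i : i \in S -> exists a, i = g a.
    suff <- : (g @: [set: 'I_k])%SET = S by case/imsetP => a _ ->; exists a.
    apply/eqP; rewrite eqEcard card_imset // cardsT card_ord.
    apply/andP; split; first by apply/fintype.subsetP => _ /imsetP[a _ ->].
    by case/andP: pat => /eqP; rewrite size_map -cardE => ->.
  split=> [i j /gsurj[a ->] /gsurj[b ->] xab|s Bs [h [hS h_lt hx]]].
    congr g; apply: (@perm_inj _ q); apply/val_inj/eqP; rewrite -[_ == _]negbK neq_ltn.
    by rewrite -!(gx : forall i j, _ = (q i < q j)) xab ltnn.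
  apply: (avq s Bs); apply/involvedE.
  have /fin_all_exists[c hc] i := gsurj _ (hS i).
  exists c; split=> [i|i j /h_lt|i j]; first by rewrite inE.
    by rewrite !hc (increasing_lt g_lt).
  by rewrite -hx !hc (gx : forall i j, _ = (q i < q j)).
have [|q qP] := @standardize #|S| (fun a => x (enum_val a)).
  by move=> a b /x_inj ab; apply: enum_val_inj; apply: ab; exact: enum_valP.
exists (existT _ #|S| q).
  move=> s Bs /involvedE[h [_ h_lt hq]]; apply: (avB s Bs).
  exists (fun i => enum_val (h i)); split=> [i|i j /h_lt/enum_val_lt //|i j].
    exact: enum_valP.
  by rewrite -hq qP.
rewrite /has_pattern size_map -cardE eqxx /=.
apply/forallP => i; apply/forallP => j; apply/eqP; rewrite qP.
have x0 := enum_val i.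
by rewrite !(nth_map x0) -?cardE // -!enum_val_nth.
Qed.

Lemma longest_Av B n (p : 'S_n) : longest (Av B) (existT _ n p) =
  \max_(S : {set 'I_n} | `[< admissible B (fun i => p i) S >]) #|S|.
Proof.
rewrite /longest /plength /=.
pose h (S : {set 'I_n}) : n.-tuple bool := [tuple i \in S | i < n].
have hbij : bijective h.
  exists (fun m => [set i | tnth m i]%SET) => [S|m].
    by apply/setP => i; rewrite inE tnth_mktuple.
  by apply: eq_from_tnth => i; rewrite tnth_mktuple inE.
have maskE S : mask (h S) (word (existT _ n p)) = [seq val (p i) | i <- enum S].
  by rewrite /word -map_mask /= -filter_mask enumT.
rewrite (reindex h (onW_bij _ hbij)); apply: eq_big => [S|S _].
  by rewrite maskE; apply: asbool_equiv_eq; exact: admissibleP.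
by rewrite maskE size_map -cardE.
Qed.

Local Open Scope classical_set_scope.
Local Open Scope ring_scope.

(** * Averages over finite types *)

Definition avg (R : realType) (I : finType) (f : I -> R) : R :=
  (\sum_i f i) / #|I|%:R.

Lemma eq_avg (R : realType) (I : finType) (f g : I -> R) :
  f =1 g -> avg f = avg g.
Proof. by move=> fg; rewrite /avg (eq_bigr _ (fun i _ => fg i)). Qed.

Lemma avg_cst (R : realType) (I : finType) (c : R) :
  (0 < #|I|)%N -> avg (fun _ : I => c) = c.
Proof.
move=> I0; rewrite /avg sumr_const -[c *+ _]mulr_natr mulfK //.
by rewrite pnatr_eq0 -lt0n.
Qed.

Lemma avgD (R : realType) (I : finType) (f g : I -> R) :
  avg (fun i => f i + g i) = avg f + avg g.
Proof. by rewrite /avg big_split mulrDl. Qed.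

Lemma avgZ (R : realType) (I : finType) (c : R) (f : I -> R) :
  avg (fun i => c * f i) = c * avg f.
Proof. by rewrite /avg -mulr_sumr mulrA. Qed.

Lemma avgB (R : realType) (I : finType) (f g : I -> R) :
  avg (fun i => f i - g i) = avg f - avg g.
Proof.
rewrite -[- avg g]mulN1r -avgZ -avgD.
by apply: eq_avg => i; rewrite mulN1r.
Qed.

Lemma avg_sum (R : realType) (I J : finType) (A : pred J) (f : J -> I -> R) :
  avg (fun i => \sum_(j | A j) f j i) = \sum_(j | A j) avg (f j).
Proof. by rewrite /avg exchange_big /= mulr_suml. Qed.

Lemma ler_avg (R : realType) (I : finType) (f g : I -> R) :
  (forall i, f i <= g i) -> avg f <= avg g.
Proof. by move=> fg; rewrite ler_wpM2r ?ler_sum ?invr_ge0. Qed.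

Lemma avg_ge0 (R : realType) (I : finType) (f : I -> R) :
  (forall i, 0 <= f i) -> 0 <= avg f.
Proof. by move=> f0; rewrite divr_ge0 ?sumr_ge0. Qed.

(** Independence of the letters of a uniform random word. *)
Lemma avg_prod (R : realType) (I V : finType) (phi : I -> V -> R) :
  avg (fun x : {ffun I -> V} => \prod_i phi i (x i)) = \prod_i avg (phi i).
Proof.
rewrite /avg -bigA_distr_bigA big_split /= prodr_const card_ffun natrX.
by rewrite exprVn.
Qed.

(** Jensen's inequality for the exponential, from its tangent at the mean. *)
Lemma expR_avg_le (R : realType) (I : finType) (f : I -> R) :
  (0 < #|I|)%N -> expR (avg f) <= avg (fun i => expR (f i)).
Proof.
move=> I0; set mu := avg f.
have step i : expR mu * (1 + (f i - mu)) <= expR (f i).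
  have -> : f i = mu + (f i - mu) by ring.
  rewrite expRD ler_wpM2l ?expR_ge0 // (_ : mu + _ - mu = f i - mu); last by ring.
  exact: expR_ge1Dx.
apply: le_trans (ler_avg step).
by rewrite avgZ avgD avg_cst // avgB avg_cst // subrr addr0 mulr1.
Qed.

(** * Exponential moments of self-bounding functions *)

(** From [expR (u / 2) <= (1 - u / 2)^-1], squared.  The range of [u] is what
makes the resulting polynomial inequality true; it includes all negative
[u]. *)
Lemma expR_le_quadratic (R : realType) (u : R) :
  u <= 1 / 3 -> expR u <= 1 + u + u ^+ 2.
Proof.
move=> u3.
have v0 : 0 < 1 - u / 2 by lra.
have e1 : expR (u / 2) <= (1 - u / 2)^-1.
  rewrite -[u / 2]opprK expRN lef_pV2 ?posrE ?expR_gt0 ?opprK //.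
  exact: expR_ge1Dx.
have -> : expR u = expR (u / 2) ^+ 2.
  by rewrite -expRM_natl; congr expR; field.
apply: (@le_trans _ _ ((1 - u / 2)^-1 ^+ 2)).
  by rewrite lerXn2r ?nnegrE ?expR_ge0 ?invr_ge0 ?(ltW v0).
rewrite exprVn -div1r ler_pdivrMr ?exprn_gt0 //.
rewrite -subr_ge0 [leRHS](_ : _ = u ^+ 2 / 4 * (1 - 3 * u + u ^+ 2)); last by field.
by rewrite mulr_ge0 ?divr_ge0 ?sqr_ge0 // addr_ge0 ?sqr_ge0 //; lra.
Qed.

(** The second moment about [c] bounds the variance, and is itself at most
[avg g - c] because [g - c] takes values in the unit interval. *)
Lemma avg_expR_le (R : realType) (V : finType) (g : V -> R) (c l : R) :
  (0 < #|V|)%N -> `|l| <= 1 / 3 -> (forall v, 0 <= g v - c <= 1) ->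
  avg (fun v => expR (l * g v)) <=
    expR (l * avg g + l ^+ 2 * (avg g - c)).
Proof.
move=> V0 l3 gc; set mu := avg g.
have mu01 : 0 <= mu - c <= 1.
  rewrite -[X in mu - X](avg_cst c V0) -avgB avg_ge0 => [|v]; last first.
    by case/andP: (gc v).
  by rewrite -[leRHS](avg_cst 1 V0); apply: ler_avg => v; case/andP: (gc v).
have step v : expR (l * g v) <=
    expR (l * mu) * (1 + l * (g v - mu) + l ^+ 2 * (g v - mu) ^+ 2).
  have -> : l * g v = l * mu + l * (g v - mu) by ring.
  rewrite expRD ler_wpM2l ?expR_ge0 // -exprMn.
  apply: expR_le_quadratic.
  apply: (le_trans (ler_norm _)); rewrite normrM -[leRHS]mulr1.
  apply: ler_pM => //.
  by have := gc v; rewrite ler_norml; lra.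
apply: (le_trans (ler_avg step)).
rewrite avgZ expRD ler_wpM2l ?expR_ge0 //.
apply: le_trans (expR_ge1Dx _).
rewrite 2!avgD avg_cst // 2!avgZ avgB avg_cst // subrr mulr0 addr0 lerD2l.
rewrite ler_wpM2l ?sqr_ge0 //.
have sq v : (g v - mu) ^+ 2 =
    (g v - c) ^+ 2 - (2 * (mu - c) * (g v - mu) + (mu - c) ^+ 2) by ring.
rewrite (eq_avg sq) avgB avgD avgZ avgB !avg_cst // subrr mulr0 add0r.
have : avg (fun v => (g v - c) ^+ 2) <= mu - c.
  rewrite -[X in mu - X](avg_cst c V0) -avgB; apply: ler_avg => v.
  by have := gc v => /andP[g0 g1]; rewrite expr2 ler_piMr.
by have := sqr_ge0 (mu - c); lra.
Qed.

Definition upd (I V : finType) (x : {ffun I -> V}) (i : I) (v : V) :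
  {ffun I -> V} := [ffun j => if j == i then v else x j].

(** [avg (fun y => h (splice S x y))] is the conditional expectation of [h] given
the letters of [x] at the positions in [S]. *)
Definition splice (I V : finType) (S : {set I}) (x y : {ffun I -> V}) :
  {ffun I -> V} := [ffun j => if j \in S then x j else y j].

(** Resampling one letter of a uniform random word leaves it uniform: swapping
the letter at [i] with the new one is an involution. *)
Lemma avg_upd (R : realType) (I V : finType) (i : I)
    (h : {ffun I -> V} -> R) : (0 < #|V|)%N ->
  avg (fun v => avg (fun y => h (upd y i v))) = avg h.
Proof.
move=> V0.
rewrite /avg -mulr_suml [X in X / _ / _ = _](_ : _ = #|V|%:R * \sum_y h y).
  by rewrite mulrAC [_ * \sum_y h y]mulrC mulfK // pnatr_eq0 -lt0n.
rewrite pair_big /=.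
pose sw (p : V * {ffun I -> V}) := (p.2 i, upd p.2 i p.1).
have swK : involutive sw.
  move=> [v y]; rewrite /sw /= ffunE eqxx; congr pair.
  by apply/ffunP => j; rewrite !ffunE; case: eqP => // ->.
rewrite (reindex_inj (inv_inj swK)) /=.
rewrite (eq_bigr (fun p : V * {ffun I -> V} => h p.2)); last first.
  move=> [v y] _; congr h => /=.
  by apply/ffunP => j; rewrite !ffunE; case: eqP => // ->.
rewrite -(pair_big xpredT xpredT (fun _ y => h y)) /=.
by rewrite sumr_const mulr_natl.
Qed.

(** The tower property, for one more revealed position. *)
Lemma avg_splice (R : realType) (I V : finType) (S : {set I}) (i : I)
    (x : {ffun I -> V}) (h : {ffun I -> V} -> R) :
  (0 < #|V|)%N -> i \notin S ->
  avg (fun y => h (splice S x y)) =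
  avg (fun v =>
    avg (fun y => h (splice (i |: S) (upd x i v) y))).
Proof.
move=> V0 iS; rewrite -(avg_upd i) //.
apply: eq_avg => v; apply: eq_avg => y; congr h; apply/ffunP => j.
rewrite !ffunE in_setU1; case: (eqVneq j i) => [->|//].
by rewrite (negPf iS).
Qed.

(** Here [fd i] stands for [f] without the help of coordinate [i].  The bound is
proved conditionally on the coordinates in [S], by induction on the number [m]
of the others, with the [m]-th harmonic number in place of the full one.  The
conditions on [l] keep the exponent reached after [m] steps at most [2 * |l|]
in absolute value, for both signs of [l]; hence the factor 4. *)
Lemma self_bounding_mgf (R : realType) (I V : finType)
    (f : {ffun I -> V} -> R) (fd : I -> {ffun I -> V} -> R) (l : R) :
  (0 < #|V|)%N ->
  (forall i x v, fd i (upd x i v) = fd i x) ->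
  (forall i x, 0 <= f x - fd i x <= 1) ->
  (forall x, \sum_i (f x - fd i x) <= f x) ->
  `|l| <= 1 / 6 -> 4 * `|l| * (\sum_(j < #|I|) j.+1%:R^-1) <= 1 ->
  avg (fun x => expR (l * f x)) <=
    expR ((l + 4 * l ^+ 2 * (\sum_(j < #|I|) j.+1%:R^-1)) * avg f).
Proof.
move=> V0 fdi fd01 fdsum l6 lH.
pose H m : R := \sum_(j < m) j.+1%:R^-1.
pose W (S : {set I}) (g : {ffun I -> V} -> R) (x : {ffun I -> V}) : R :=
    avg (fun y => g (splice S x y)).
have T0 : (0 < #|{ffun I -> V}|)%N by rewrite card_ffun expn_gt0 V0.
have H_le m : (m <= #|I|)%N -> 0 <= H m <= H #|I|.
  move=> mI; rewrite sumr_ge0 //= /H -(subnKC mI) big_split_ord /= lerDl.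
  by rewrite sumr_ge0.
suff key m : forall (S : {set I}) x, #|~: S| = m ->
    W S (fun y => expR (l * f y)) x <= expR ((l + 4 * l ^+ 2 * H m) * W S f x).
  have /card_gt0P[x0 _] := T0.
  have W0 g : W finset.set0 g x0 = avg g.
    by apply: eq_avg => y; congr g; apply/ffunP => j; rewrite ffunE inE.
  by have := key _ finset.set0 x0 erefl; rewrite !W0 finset.setC0 cardsT.
elim: m => [|m IH] S x Sm.
  have mS y : splice S x y = x.
    apply/ffunP => j; rewrite ffunE; case: ifP => // /negbT jS.
    by have /eqP := Sm; rewrite cards_eq0 => /eqP/setP/(_ j); rewrite !inE jS.
  have WS g : W S g x = g x.
    by rewrite /W (@eq_avg _ _ _ (fun=> g x)) ?avg_cst // => y; rewrite mS.
  by rewrite !WS /H big_ord0 mulr0 addr0.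
have /andP[Hm0 HmI] : 0 <= H m <= H #|I|.
  by apply: H_le; rewrite (leq_trans (leqnSn m)) // -Sm max_card.
set lm := l + 4 * l ^+ 2 * H m in IH.
have lm2 : `|lm| <= 2 * `|l|.
  apply: (le_trans (ler_normD _ _)).
  suff : `|4 * l ^+ 2 * H m| <= `|l| by lra.
  have l2H : 0 <= 4 * l ^+ 2 * H m by rewrite mulr_ge0 // mulr_ge0 // sqr_ge0.
  rewrite [`|_ * H m|]ger0_norm // -[l ^+ 2]real_normK ?num_real //.
  rewrite expr2 mulrA mulrAC -[leRHS]mul1r ler_wpM2r //; apply: le_trans lH.
  by rewrite ler_wpM2l // mulr_ge0.
(* the hidden influences have mean at most W S f x / m.+1; some hidden
   coordinate is not above the mean *)
have [i iS ih] : exists2 i, i \notin S &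
    W S f x - W S (fd i) x <= W S f x / m.+1%:R.
  apply/exists_inP; apply: contraT; rewrite negb_exists_in => /forall_inP no.
  have : \sum_(i in ~: S) (W S f x / m.+1%:R) <
         \sum_(i in ~: S) (W S f x - W S (fd i) x).
    apply: ltr_sum => [|i]; last by rewrite inE => /no; rewrite -ltNge.
    apply/hasP; have /card_gt0P[i iS] : (0 < #|~: S|)%N by rewrite Sm.
    by exists i; rewrite ?mem_index_enum.
  rewrite sumr_const Sm -[ltLHS]mulr_natr divfK ?pnatr_eq0 // ltNge => /negP[].
  rewrite (eq_bigr (fun i => W S (fun y => f y - fd i y) x)); last first.
    by move=> i _; rewrite -avgB.
  rewrite -avg_sum; apply: ler_avg => y; apply: le_trans (fdsum _).
  rewrite [leRHS](bigID (mem (~: S))) /= lerDl sumr_ge0 // => i _.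
  by case/andP: (fd01 i (splice S x y)).
have tower g : W S g x = avg (fun v => W (i |: S) g (upd x i v)).
  exact: avg_splice.
have iSm : #|~: (i |: S)| = m.
  have := cardsC (i |: S); have := cardsC S; rewrite cardsU1 iS Sm; lia.
(* c is known before coordinate i is revealed, as fd i does not depend on it *)
pose c := W S (fd i) x.
have Wfd v : W (i |: S) (fd i) (upd x i v) = c.
  apply: eq_avg => y; rewrite -[RHS](fdi i _ v); congr (fd i _).
  apply/ffunP => j; rewrite !ffunE in_setU1.
  by case: (eqVneq j i) => [->|//].
rewrite tower; apply: (@le_trans _ _
    (avg (fun v => expR (lm * W (i |: S) f (upd x i v))))).
  by apply: ler_avg => v; exact: IH.
apply: (le_trans (avg_expR_le (c := c) V0 _ _)).
- by apply: (le_trans lm2); lra.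
- move=> v; rewrite -(Wfd v) -avgB avg_ge0 => [|y].
    rewrite -[leRHS](avg_cst 1 T0); apply: ler_avg => y.
    by case/andP: (fd01 i (splice (i |: S) (upd x i v) y)).
  by case/andP: (fd01 i (splice (i |: S) (upd x i v) y)).
rewrite -tower ler_expR.
have WS0 : 0 <= W S f x.
  apply: avg_ge0 => y; apply: le_trans (fdsum _); apply: sumr_ge0 => j _.
  by case/andP: (fd01 j (splice S x y)).
(* the extra term 4 * l ^+ 2 / m.+1 pays for the squared exponent times the
   influence, since lm ^+ 2 <= 4 * l ^+ 2 and by the choice of i *)
have -> : (l + 4 * l ^+ 2 * H m.+1) * W S f x =
    lm * W S f x + 4 * l ^+ 2 * (W S f x / m.+1%:R).
  by rewrite /H big_ord_recr /= /lm /H; ring.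
rewrite lerD2l; apply: ler_pM => //; first exact: sqr_ge0.
  by rewrite -avgB avg_ge0 // => y; case/andP: (fd01 i (splice S x y)).
rewrite -[lm ^+ 2]real_normK ?num_real // -[l ^+ 2]real_normK ?num_real //.
have := ler_pM (normr_ge0 _) (normr_ge0 _) lm2 lm2.
by rewrite -!expr2 => /le_trans -> //; rewrite exprMn -natrX.
Qed.

Definition largest (I V : finType) (G : {ffun I -> V} -> {set I} -> bool)
  (x : {ffun I -> V}) : nat := (\max_(S | G x S) #|S|)%N.

Lemma largest_attained (I V : finType)
    (G : {ffun I -> V} -> {set I} -> bool) x :
  G x finset.set0 -> exists2 S, G x S & largest G x = #|S|.
Proof.
move=> G0; have [|S GS fS] := @eq_bigmax_cond _ (G x) (fun S : {set I} => #|S|).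
  by apply/card_gt0P; exists finset.set0; exact: G0.
by exists S => //; exact: fS.
Qed.

(** The largest cardinal of a set in a hereditary family, whose membership
depends only on the letters in the set, is self-bounding: forbidding one
position costs at most 1, and costs nothing outside a fixed optimal set. *)
Lemma largest_mgf (R : realType) (I V : finType)
    (G : {ffun I -> V} -> {set I} -> bool) (l : R) :
  (0 < #|V|)%N ->
  (forall x, G x finset.set0) ->
  (forall x (S S' : {set I}), S' \subset S -> G x S -> G x S') ->
  (forall (x y : {ffun I -> V}) (S : {set I}),
     {in S, x =1 y} -> G x S -> G y S) ->
  `|l| <= 1 / 6 -> 4 * `|l| * (\sum_(j < #|I|) j.+1%:R^-1) <= 1 ->
  avg (fun x => expR (l * (largest G x)%:R)) <=
    expR ((l + 4 * l ^+ 2 * (\sum_(j < #|I|) j.+1%:R^-1)) *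
          avg (fun x => (largest G x)%:R)).
Proof.
move=> V0 G0 Gsub Gloc l6 lH.
pose fd i x := (\max_(S : {set I} | G x S && (i \notin S)) #|S|)%N.
have fd_le i x : (fd i x <= largest G x)%N.
  apply/bigmax_leqP => S /andP[GS _].
  by rewrite /largest (bigop.bigmax_sup S).
have le_fd i x : (largest G x <= (fd i x).+1)%N.
  apply/bigmax_leqP => S GS; rewrite (cardsD1 i S).
  have : (#|S :\ i| <= fd i x)%N.
    by rewrite /fd (bigop.bigmax_sup (S :\ i)%SET) // (Gsub _ S) ?subD1set //= !inE eqxx.
  by case: (i \in S) => /=; lia.
apply: (@self_bounding_mgf _ _ _ _ (fun i x => (fd i x)%:R)) => //.
- move=> i x v; congr (_%:R); apply: eq_bigl => S.
  case: (boolP (i \in S)) => [_|iS]; first by rewrite !andbF.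
  rewrite !andbT; apply/idP/idP; apply: Gloc => j jS; rewrite ffunE;
    by case: eqP => // ji; rewrite -ji jS in iS.
- move=> i x; rewrite subr_ge0 ler_nat fd_le lerBlDr nat1r ler_nat.
  exact: le_fd.
- move=> x; have [S GS fS] := largest_attained (G0 x).
  rewrite [leRHS](_ : _ = \sum_i (i \in S)%:R); last first.
    by rewrite fS -sum1_card big_mkcond natr_sum.
  apply: ler_sum => i _; case: (boolP (i \in S)) => iS.
    by rewrite lerBlDr nat1r ler_nat le_fd.
  by rewrite subr_le0 ler_nat fS /fd (bigop.bigmax_sup S) ?GS.
Qed.

(** * Random words with independent letters *)

Definition admissible_word (B : set permutation) n N (x : {ffun 'I_n -> 'I_N})
  (S : {set 'I_n}) : bool := `[< admissible B (fun i => x i) S >].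

Lemma admissible_word0 B n N (x : {ffun 'I_n -> 'I_N}) :
  (forall q, B q -> (1 <= plength q)%N) -> admissible_word B x finset.set0.
Proof.
move=> B1; apply/asboolP; split=> [i j|q /B1 q1 [g [gS _ _]]].
  by rewrite inE.
by have := gS (Ordinal q1); rewrite inE.
Qed.

Lemma admissible_word_sub B n N (x : {ffun 'I_n -> 'I_N}) (S S' : {set 'I_n}) :
  S' \subset S -> admissible_word B x S -> admissible_word B x S'.
Proof.
move/fintype.subsetP => S'S /asboolP[x_inj av]; apply/asboolP.
split=> [i j /S'S iS /S'S jS|q Bq [g [gS g_lt gx]]]; first exact: x_inj.
by apply: (av q Bq); exists g; split=> // i; exact/S'S/gS.
Qed.

Lemma admissible_word_local B n N (x y : {ffun 'I_n -> 'I_N}) (S : {set 'I_n}) :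
  {in S, x =1 y} -> admissible_word B x S -> admissible_word B y S.
Proof.
move=> xy /asboolP[x_inj av]; apply/asboolP.
split=> [i j iS jS|q Bq [g [gS g_lt gx]]].
  by rewrite -!xy //; exact: x_inj.
apply: (av q Bq); exists g; split=> // i j.
by rewrite !xy.
Qed.

Lemma card_block n m a : (0 < m)%N ->
  (#|[set i : 'I_n | (i %/ m == a)%N]%SET| <= m)%N.
Proof.
move=> m0; pose r (i : 'I_n) : 'I_m := Ordinal (ltn_pmod i m0).
rewrite -[leqRHS]card_ord -(@card_in_imset _ _ r) ?max_card // => i j.
rewrite !inE => /eqP ia /eqP ja [ij]; apply: val_inj => /=.
by rewrite (divn_eq i m) (divn_eq j m) ia ja ij.
Qed.

Definition cell_count n N (m M : nat) (x : {ffun 'I_n -> 'I_N}) (a c : nat) :=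
  #|[set i : 'I_n | (i %/ m == a)%N && (x i %/ M == c)%N]%SET|.

(** Each of the at most [m] positions of the row of the cell falls into it with
probability [1 / m], so the average is at most
[(1 + (expR 1 - 1) / m) ^+ m]. *)
Lemma avg_expR_cell_count (R : realType) n m M a c : (0 < m)%N -> (0 < M)%N ->
  avg (fun x : {ffun 'I_n -> 'I_(m * M)} => expR (cell_count m M x a c)%:R) <=
    expR (expR 1 - 1 : R).
Proof.
move=> m0 M0; set e : R := expR 1.
have e1 : 1 <= e by rewrite /e -[leLHS]expR0 ler_expR.
have N0 : (0 < #|'I_(m * M)|)%N by rewrite card_ord muln_gt0 m0.
(* the exponential of the count is a product of functions of single letters *)
pose phi (i : 'I_n) (v : 'I_(m * M)) : R :=
  if (i %/ m == a)%N && (v %/ M == c)%N then e else 1.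
rewrite (@eq_avg _ _ _ (fun x : {ffun 'I_n -> 'I_(m * M)} =>
    \prod_i phi i (x i))); last first.
  move=> x; rewrite /phi -big_mkcond prodr_const /= -expRM_natl mulr1.
  by congr (expR _%:R); rewrite /cell_count cardsE.
have phi_le i : avg (phi i) <= if (i %/ m == a)%N then expR ((e - 1) / m%:R) else 1.
  case: ifP => ia; last first.
    by rewrite (@eq_avg _ _ _ (fun=> 1)) ?avg_cst // => v; rewrite /phi ia.
  apply: le_trans (expR_ge1Dx _).
  rewrite (@eq_avg _ _ _ (fun v : 'I_(m * M) =>
    1 + (e - 1) * (v %/ M == c)%N%:R)); last first.
    by move=> v; rewrite /phi ia /=; case: eqP => _; rewrite ?mulr1 ?mulr0; ring.
  rewrite avgD avg_cst // avgZ lerD2l ler_wpM2l ?subr_ge0 //.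
  rewrite /avg -natr_sum card_ord natrM.
  rewrite invfM mulrCA -[leRHS]mulr1 ler_wpM2l ?invr_ge0 //.
  rewrite ler_pdivrMr ?ltr0n // mul1r ler_nat.
  by rewrite -big_mkcond /= sum1dep_card card_block.
rewrite avg_prod; apply: (@le_trans _ _
    (\prod_(i < n) if (i %/ m == a)%N then expR ((e - 1) / m%:R) else 1)).
  apply: ler_prod => i _; rewrite phi_le andbT; apply: avg_ge0 => v.
  by rewrite /phi; case: ifP => _; rewrite ?expR_ge0.
rewrite -big_mkcond prodr_const /= -expRM_natl ler_expR.
rewrite mulrCA -[leRHS]mulr1 ler_wpM2l ?subr_ge0 //.
rewrite ler_pdivrMr ?ltr0n // mul1r ler_nat -cardsE.
exact: card_block.
Qed.

(** Points in cells of distinct rows and columns are ordered like the cells, so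
an occurrence among the cells lifts to one among the points. *)
Lemma occurs_in_cells (B : set permutation) q n N m M
    (x : {ffun 'I_n -> 'I_N}) (S : {set 'I_n}) :
  B q -> admissible B (fun i => x i) S ->
  ~ occurs (tagged q) (fun a c =>
      [exists i in S, (i %/ m == a)%N && (x i %/ M == c)%N]).
Proof.
move=> Bq [_ /(_ q Bq) av] [gx [gy [ge gx_lt gy_lt]]]; apply: av.
have /fin_all_exists[g gP] a : exists i, (i \in S) &&
    ((i %/ m == gx a)%N && (x i %/ M == gy a)%N).
  by have /existsP := ge a.
have gS a : g a \in S by case/andP: (gP a).
have gm a : (g a %/ m = gx a)%N by case/and3P: (gP a) => _ /eqP.
have gM a : (x (g a) %/ M = gy a)%N by case/and3P: (gP a) => _ _ /eqP.
exists g; split=> // a b; first last.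
  have lt (u v : 'I_(plength q)) : (tagged q u < tagged q v)%N ->
      (x (g u) < x (g v))%N.
    by move/gy_lt; apply: contraTT; rewrite -!leqNgt -!gM; exact: leq_div2r.
  case: (ltngtP (tagged q a) (tagged q b)) => [/lt ->//|/lt ba|].
    by apply/negbTE; rewrite -leqNgt ltnW.
  by move/val_inj/perm_inj => ->; rewrite ltnn.
by move/gx_lt; apply: contraTT; rewrite -!leqNgt -!gm; exact: leq_div2r.
Qed.

(** A cell with [c] points contributes [c <= T + expR (c - T)].  The terms [T]
are summed over the few cells met by [S], the exponentials over all
cells. *)
Lemma admissible_card_le (R : realType) (B : set permutation) q C n m M
    (x : {ffun 'I_n -> 'I_(m * M)}) (S : {set 'I_n}) (T : R) :
  B q -> (n <= m ^ 2)%N -> (0 < m)%N -> (0 < M)%N ->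
  (forall e, ~ occurs (tagged q) e -> (entries m e <= C * m)%N) ->
  0 <= T -> admissible B (fun i => x i) S ->
  #|S|%:R <= C%:R * m%:R * T +
    \sum_(a < m) \sum_(c < m) expR ((cell_count m M x a c)%:R - T).
Proof.
move=> Bq nm m0 M0 hC T0 /(occurs_in_cells (m := m) (M := M) Bq)/hC.
set e := (fun a c => _) => e_le.
have row_lt (i : 'I_n) : (i %/ m < m)%N.
  by rewrite ltn_divLR // mulnn (leq_trans (ltn_ord i)).
have col_lt (i : 'I_n) : (x i %/ M < m)%N by rewrite ltn_divLR.
pose cell i := (Ordinal (row_lt i), Ordinal (col_lt i)).
have S_le : (#|S| <= \sum_(a < m) \sum_(c < m) e a c * cell_count m M x a c)%N.
  rewrite -sum1_card (partition_big cell xpredT) //= pair_big /=.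
  apply: leq_sum => -[a c] _ /=; rewrite sum1dep_card.
  case E : (e a c).
    rewrite mul1n subset_leq_card //; apply/fintype.subsetP => i.
    by rewrite !inE => /andP[_ /eqP[<- <-]] /=; rewrite !eqxx.
  rewrite mul0n leqn0 cards_eq0; apply/eqP/setP => i; rewrite !inE.
  apply/negP => /andP[iS /eqP[ia ic]]; suff : e a c by rewrite E.
  by apply/existsP; exists i; rewrite iS -ia -ic !eqxx.
apply: (@le_trans _ _ (\sum_(a < m) \sum_(c < m)
    (T * (e a c)%:R + expR ((cell_count m M x a c)%:R - T)))).
  apply: (@le_trans _ _ (\sum_(a < m) \sum_(c < m)
    (e a c * cell_count m M x a c)%N%:R)).
    under eq_bigr do rewrite -natr_sum.
    by rewrite -natr_sum ler_nat.
  apply: ler_sum => a _; apply: ler_sum => c _.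
  case: (e a c); last by rewrite mul0n mulr0 add0r expR_ge0.
  rewrite mul1n mulr1.
  by have := expR_ge1Dx ((cell_count m M x a c)%:R - T); lra.
under eq_bigr do rewrite big_split /=.
rewrite big_split lerD2r /=.
under eq_bigr do rewrite -mulr_sumr -natr_sum.
rewrite -mulr_sumr -natr_sum mulrC ler_wpM2r // -natrM ler_nat.
exact: e_le.
Qed.

(** [admissible_card_le] with [T = ln m], for which the [m ^ 2] exponentials
have total mean [O(m)]. *)
Lemma avg_largest_admissible_le (R : realType) (B : set permutation) q C n m M :
  (forall q, B q -> (1 <= plength q)%N) ->
  B q -> (n <= m ^ 2)%N -> (0 < m)%N -> (0 < M)%N ->
  (forall e, ~ occurs (tagged q) e -> (entries m e <= C * m)%N) ->
  avg (fun x : {ffun 'I_n -> 'I_(m * M)} =>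
    (largest (@admissible_word B n (m * M)) x)%:R) <=
  C%:R * m%:R * ln m%:R + m%:R * expR (expR 1 - 1) :> R.
Proof.
move=> B1 Bq nm m0 M0 hC.
have N0 : (0 < #|{ffun 'I_n -> 'I_(m * M)}|)%N.
  by rewrite card_ffun card_ord expn_gt0 muln_gt0 m0 M0.
have m0R : 0 < m%:R :> R by rewrite ltr0n.
have T0 : 0 <= ln m%:R :> R by rewrite ln_ge0 // ler1n.
apply: (@le_trans _ _ (avg (fun x : {ffun 'I_n -> 'I_(m * M)} =>
  C%:R * m%:R * ln m%:R +
  \sum_(a < m) \sum_(c < m) m%:R^-1 * expR (cell_count m M x a c)%:R))).
  apply: ler_avg => x.
  have -> : \sum_(a < m) \sum_(c < m) m%:R^-1 * expR (cell_count m M x a c)%:R =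
    \sum_(a < m) \sum_(c < m) expR ((cell_count m M x a c)%:R - ln m%:R) :> R.
    apply: eq_bigr => a _; apply: eq_bigr => c _.
    by rewrite addrC expRD expRN lnK.
  have [S /asboolP admS ->] := largest_attained (admissible_word0 x B1).
  exact: (admissible_card_le Bq nm m0 M0 hC T0 admS).
rewrite avgD avg_cst // lerD2l avg_sum.
apply: (@le_trans _ _ (\sum_(a < m) \sum_(c < m) m%:R^-1 * expR (expR 1 - 1))).
  apply: ler_sum => a _; rewrite avg_sum; apply: ler_sum => c _.
  by rewrite avgZ ler_wpM2l ?invr_ge0 ?ler0n // avg_expR_cell_count.
rewrite !sumr_const card_ord -[leLHS]mulr_natl -[X in _ * X]mulr_natl mulVKf //.
by rewrite gt_eqF.
Qed.

(** * From words to permutations *)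

Lemma admissible_order B n (x y : 'I_n -> nat) S :
  (forall i j, (x i < x j)%N = (y i < y j)%N) ->
  admissible B x S -> admissible B y S.
Proof.
move=> xy [x_inj av]; split=> [i j iS jS yij|q Bq [g [gS g_lt gy]]].
  apply: x_inj => //; apply/eqP; rewrite -[_ == _]negbK neq_ltn.
  by rewrite !xy yij ltnn.
by apply: (av q Bq); exists g; split=> // i j; rewrite xy.
Qed.

(** With [q] the pattern of [x], the word [x \o p] is ordered like [p * q]. *)
Lemma largest_comp_perm B n N (x : {ffun 'I_n -> 'I_N}) : injective x ->
  exists q : 'S_n, forall p : 'S_n,
    largest (@admissible_word B n N) [ffun i => x (p i)] =
    longest (Av B) (existT _ n (p * q)%g).
Proof.
move=> x_inj; have [|q qx] := @standardize n (fun i => x i).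
  by move=> i j /val_inj/x_inj.
exists q => p; rewrite longest_Av; apply: eq_bigl => S.
apply: asbool_equiv_eq; split; apply: admissible_order => i j;
  by rewrite !permM qx !ffunE.
Qed.

(** At least half of the words are injective: the proportion of injective ones
is at least [1 - n ^ 2 / N]. *)
Lemma leq_expn_ffact n N : (2 * n ^ 2 <= N)%N -> (N ^ n <= 2 * N ^_ n)%N.
Proof.
move=> nN; suff key j : (j <= n)%N -> (N ^ j * (N - j ^ 2) <= N ^_ j * N)%N.
  case: n nN key => [|n] nN key; first by rewrite ffactn0.
  have := key _ (leqnn _).
  set u := (N ^ n.+1)%N; set v := (N ^_ n.+1)%N; nia.
elim: j => [|j IH] jn; first by rewrite ffactn0 expn0 subn0.
have {}IH := IH (ltnW jn).
have jN : ((j.+1) ^ 2 <= N)%N by nia.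
rewrite ffactnSr expnSr.
set u := (N ^ j)%N in IH *; set v := (N ^_ j)%N in IH *.
apply: (@leq_trans (u * (N - j ^ 2) * (N - j))%N); last first.
  by rewrite -[(v * _ * N)%N]mulnAC leq_mul2r IH orbT.
rewrite -!mulnA leq_mul2l; apply/orP; right; nia.
Qed.

(** Permuting positions preserves the law of the word and its injectivity, while
for a fixed injective word [x] and a uniform permutation [p] the pattern of
[x \o p] is uniform.  Averaging over both gives equality for the average
restricted to injective words, and dropping the other words costs the
factor 2. *)
Lemma avg_longest_le (R : realType) B n N (F : nat -> R) :
  (2 * n ^ 2 <= N)%N -> (forall k, 0 <= F k) ->
  avg (fun p : 'S_n => F (longest (Av B) (existT _ n p))) <=
  2 * avg (fun x : {ffun 'I_n -> 'I_N} =>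
             F (largest (@admissible_word B n N) x)).
Proof.
move=> nN F0; set f := largest _.
set L := fun p : 'S_n => longest (Av B) (existT _ n p).
have inner (x : {ffun 'I_n -> 'I_N}) : injectiveb x ->
    \sum_(p : 'S_n) F (f [ffun i => x (p i)]) = \sum_(p : 'S_n) F (L p).
  move/injectiveP => /(largest_comp_perm B)[q fq].
  rewrite [RHS](reindex_inj (mulIg q)); apply: eq_bigr => p _.
  by rewrite /f fq.
have swap (p : 'S_n) :
    \sum_(x : {ffun 'I_n -> 'I_N} | injectiveb x) F (f [ffun i => x (p i)]) =
    \sum_(x : {ffun 'I_n -> 'I_N} | injectiveb x) F (f x).
  have compK (s : 'S_n) : cancel (fun x : {ffun 'I_n -> 'I_N} => [ffun i => x (s i)])
      (fun x => [ffun i => x ((s^-1)%g i)]).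
    by move=> x; apply/ffunP => i; rewrite !ffunE permKV.
  rewrite [RHS](reindex_inj (can_inj (compK p))); apply: eq_bigl => x.
  apply/injectiveP/injectiveP => [x_inj i j|x_inj i j xij].
    by rewrite !ffunE => /x_inj/perm_inj.
  apply: (@perm_inj _ (p^-1)%g); apply: x_inj.
  by rewrite !ffunE !permKV.
have dbl : n`!%:R * \sum_(x : {ffun 'I_n -> 'I_N} | injectiveb x) F (f x) =
    (N ^_ n)%:R * \sum_(p : 'S_n) F (L p).
  transitivity (\sum_(p : 'S_n) \sum_(x : {ffun 'I_n -> 'I_N} | injectiveb x)
      F (f [ffun i => x (p i)])).
    by rewrite (eq_bigr _ (fun p _ => swap p)) sumr_const card_Sn mulr_natl.
  rewrite exchange_big /= (eq_bigr _ inner).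
  rewrite sumr_const -[LHS]mulr_natl; congr (_%:R * _).
  have := card_inj_ffuns 'I_n 'I_N; rewrite !card_ord => <-.
  by rewrite cardsE.
rewrite /avg card_Sn card_ffun !card_ord.
case: (posnP (N ^ n)%N) => [Nn0|Nn_gt0].
  have n0 : (0 < n)%N by case: (n) Nn0.
  have N0 : (0 < N)%N by apply: leq_trans nN; rewrite muln_gt0 expn_gt0 n0.
  by have := expn_gt0 N n; rewrite Nn0 N0.
rewrite mulrA ler_pdivlMr ?ltr0n // mulrAC ler_pdivrMr ?ltr0n ?fact_gt0 //.
apply: (@le_trans _ _ (2 * (N ^_ n)%:R * \sum_(p : 'S_n) F (L p))).
  rewrite mulrC ler_wpM2r ?sumr_ge0 // -natrM ler_nat.
  exact: leq_expn_ffact.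
rewrite -mulrA -dbl mulrCA mulrC ler_wpM2r // ler_wpM2l //.
rewrite [leRHS](bigID (fun x : {ffun 'I_n -> 'I_N} => injectiveb x)) /= lerDl.
by rewrite sumr_ge0.
Qed.

(** Exponential Markov inequality on both sides.  The centre is the mean of [g]
and not the parameter [mu] of the hypotheses: Jensen's inequality for [- l]
bounds the factor [expR (- l * avg g)] by the second hypothesis, the terms in
[mu] cancel, and the only cost is a doubled [V]. *)
Lemma avg_centered_tail (R : realType) (I : finType) (g : I -> R) (l mu V t : R) :
  (0 < #|I|)%N -> 0 <= l ->
  avg (fun i => expR (l * g i)) <= 2 * expR (l * mu + V) ->
  avg (fun i => expR (- l * g i)) <= 2 * expR (- l * mu + V) ->
  avg (fun i => (t <= `|g i - avg g|)%R%:R) <= 8 * expR (2 * V - l * t).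
Proof.
move=> I0 l0 up dn; set m := avg g.
have jup : expR (l * m) <= 2 * expR (l * mu + V).
  by apply: le_trans up; rewrite /m -avgZ; exact: expR_avg_le.
have jdn : expR (- l * m) <= 2 * expR (- l * mu + V).
  by apply: le_trans dn; rewrite /m -avgZ; exact: expR_avg_le.
have markov i : (t <= `|g i - m|)%R%:R <= expR (- (l * t)) *
    (expR (- l * m) * expR (l * g i) + expR (l * m) * expR (- l * g i)).
  case: (leP t `|g i - m|) => [tg|_]; rewrite ?mulr1n ?mulr0n; last first.
    by rewrite mulr_ge0 ?addr_ge0 ?mulr_ge0 ?expR_ge0.
  rewrite -!expRD mulrDr -!expRD.
  have [gm|gm] := leP 0 (g i - m).
    rewrite ger0_norm // in tg; rewrite -[leLHS]addr0 lerD ?expR_ge0 //.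
    rewrite -[leLHS]expR0 ler_expR.
    have := ler_wpM2l l0 tg; lra.
  rewrite ltr0_norm // in tg; rewrite -[leLHS]add0r lerD ?expR_ge0 //.
  rewrite -[leLHS]expR0 ler_expR.
  have := ler_wpM2l l0 tg; lra.
apply: (le_trans (ler_avg markov)).
rewrite avgZ avgD !avgZ.
have -> : 8 * expR (2 * V - l * t) =
   expR (- (l * t)) * (2 * expR (- l * mu + V) * (2 * expR (l * mu + V)) +
     2 * expR (l * mu + V) * (2 * expR (- l * mu + V))).
  have -> : 2 * V - l * t = - (l * t) + ((- l * mu + V) + (l * mu + V)) by ring.
  by rewrite !expRD; ring.
rewrite ler_wpM2l ?expR_ge0 // lerD // ler_pM ?expR_ge0 // avg_ge0 // => i;
  exact: expR_ge0.
Qed.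

Lemma longest_tail (R : realType) B n N (l t : R) :
  let mu := avg (fun x : {ffun 'I_n -> 'I_N} =>
                   (largest (@admissible_word B n N) x)%:R) in
  let H := \sum_(j < n) j.+1%:R^-1 in
  let L (p : 'S_n) : R := (longest (Av B) (existT _ n p))%:R in
  (forall q, B q -> (1 <= plength q)%N) ->
  (2 * n ^ 2 <= N)%N -> (0 < N)%N ->
  0 <= l -> l <= 1 / 6 -> 4 * l * H <= 1 ->
  avg (fun p => (t <= `|L p - avg L|)%R%:R) <=
    8 * expR (8 * l ^+ 2 * H * mu - l * t).
Proof.
move=> mu H L B1 nN N0 l0 l6 lH.
have mgf (l' : R) : `|l'| = l ->
    avg (fun p => expR (l' * L p)) <= 2 * expR (l' * mu + 4 * l ^+ 2 * H * mu).
  move=> ll'; have l2 : l' ^+ 2 = l ^+ 2 by rewrite -ll' real_normK ?num_real.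
  have := avg_longest_le B (F := fun k => expR (l' * k%:R)) nN (fun=> expR_ge0 _).
  move/le_trans; apply; rewrite ler_wpM2l // -mulrDl -l2.
  have := @largest_mgf R _ _ (@admissible_word B n N) l'.
  rewrite !card_ord ll'; apply => //.
  - by move=> x; exact: admissible_word0.
  - by move=> x S S'; exact: admissible_word_sub.
  - by move=> x y S; exact: admissible_word_local.
have -> : 8 * l ^+ 2 * H * mu = 2 * (4 * l ^+ 2 * H * mu) by ring.
apply: avg_centered_tail => //.
- by rewrite card_Sn fact_gt0.
- by apply: mgf; rewrite ger0_norm.
- by apply: mgf; rewrite normrN ger0_norm.
Qed.

(** * Asymptotics *)

Lemma near_powR_le (R : realType) (C a b : R) : a < b ->
  \forall n \near \oo, C * n%:R `^ a <= n%:R `^ b.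
Proof.
move=> ab; have e0 : 0 < b - a by rewrite subr_gt0.
have [n1 _ n1P] := nbhs_infty_ger (1 : R).
have [n2 _ n2P] := nbhs_infty_ger (Num.max C 1 `^ (b - a)^-1).
exists (maxn n1 n2) => // n /=; rewrite geq_max => /andP[/n1P /= n_ge1 /n2P /= nC].
have n0 : n%:R != 0 :> R by rewrite gt_eqF // (lt_le_trans ltr01).
rewrite -(subrK a b) powRD ?n0 ?implybT // ler_wpM2r ?powR_ge0 //.
apply: (@le_trans _ _ (Num.max C 1)); first by rewrite le_max lexx.
have C0 : 0 <= Num.max C 1 by rewrite le_max ler01 orbT.
have -> : Num.max C 1 = (Num.max C 1 `^ (b - a)^-1) `^ (b - a).
  by rewrite -powRrM mulVf ?gt_eqF // powRr1.
by apply: ge0_ler_powR; rewrite ?nnegrE ?powR_ge0 ?(ltW e0) ?ler0n.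
Qed.

Lemma ln_le_powR (R : realType) (x e : R) : 0 < e -> ln x <= x `^ e / e.
Proof.
move=> e0; rewrite ler_pdivlMr // mulrC -ln_powR.
have [/ln0 ->|x0] := leP (x `^ e) 0; first exact: powR_ge0.
apply: le_trans (le_ln1Dx _); last by have := powR_ge0 x e; lra.
by rewrite ler_ln ?posrE //; have := powR_ge0 x e; lra.
Qed.

Lemma harmonic_sum_le (R : realType) n : (0 < n)%N ->
  \sum_(j < n) j.+1%:R^-1 <= 1 + ln n%:R :> R.
Proof.
case: n => // n _; elim: n => [|n IH].
  by rewrite big_ord1 invr1 ln1 addr0.
rewrite big_ord_recr /=.
have : ln (1 - n.+2%:R^-1) <= - n.+2%:R^-1 :> R.
  apply: le_ln1Dx; rewrite ltrN2 invf_lt1 ?ltr0n // ltr1n //.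
have -> : 1 - n.+2%:R^-1 = n.+1%:R / n.+2%:R :> R.
  by rewrite -[in n.+1%:R](addnK 1%N n.+1) addn1 natrB // mulrBl divff ?mul1r ?pnatr_eq0.
rewrite ln_div ?posrE ?ltr0n //; move: IH.
move: (\sum_(j < _) _) (n.+2%:R^-1) (ln n.+1%:R) (ln n.+2%:R) => a b c d; lra.
Qed.

Lemma harmonic_sum_powR (R : realType) (e : R) n : 0 < e -> (0 < n)%N ->
  \sum_(j < n) j.+1%:R^-1 <= (1 + e^-1) * n%:R `^ e.
Proof.
move=> e0 n0; apply: (le_trans (harmonic_sum_le R n0)).
have := @ln_le_powR R n%:R e e0.
have n1 : 1 <= n%:R `^ e.
  by rewrite -[leLHS](powRr0 n%:R) ler_powR ?ler1n // ltW.
by rewrite mulrDl mul1r [e^-1 * _]mulrC; lra.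
Qed.

(** The logarithm of [avg_largest_admissible_le] is absorbed into the exponent
[e].  The grid has side [m = s ^ j] with [n <= m ^ 2 <= s ^ 2 * n], and [N] is
a multiple of [m], so that columns have equal widths, that is at least
[2 * n ^ 2], as required for comparison with permutations. *)
Lemma avg_largest_powR (R : realType) (B : set permutation) q (e : R) :
  (forall q, B q -> (1 <= plength q)%N) -> B q -> 0 < e ->
  exists C : R, 0 <= C /\ forall n, (0 < n)%N -> exists N,
    [/\ (2 * n ^ 2 <= N)%N, (0 < N)%N &
     avg (fun x : {ffun 'I_n -> 'I_N} =>
         (largest (@admissible_word B n N) x)%:R) <=
       C * n%:R `^ (1 / 2 + e)].
Proof.
move=> B1 Bq e0; have [C MT] := marcus_tardos (tagged q).
set s := ((plength q).+1 ^ 2)%N in MT.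
have s1 : (1 < s)%N by rewrite /s; have := B1 q Bq; nia.
pose K : R := expR (expR 1 - 1).
have e2 : 0 < 2 * e by lra.
pose C1 : R := C%:R / (2 * e) + K.
have C10 : 0 <= C1 by rewrite addr_ge0 ?expR_ge0 // divr_ge0 // ltW.
exists (C1 * s%:R `^ (1 + 2 * e)); split=> [|n n0].
  by rewrite mulr_ge0 ?powR_ge0.
pose j := up_log (s ^ 2) n; pose m := (s ^ j)%N.
have s21 : (1 < s ^ 2)%N by nia.
have m0 : (0 < m)%N by rewrite expn_gt0 (ltnW s1).
have m2E : (m ^ 2 = (s ^ 2) ^ j)%N by rewrite /m -expnM mulnC expnM.
have nm : (n <= m ^ 2)%N by rewrite m2E up_logP.
have mn : (m ^ 2 <= s ^ 2 * n)%N.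
  rewrite m2E /j; case: (ltngtP 1 n) => [n1|n1|<-].
  - have /andP[+ _] := up_log_bounds s21 n1.
    have : (0 < up_log (s ^ 2) n)%N by rewrite up_log_gt0 s21.
    case: (up_log _ _) => // i _ /= lt; rewrite expnS leq_mul2l.
    by rewrite (ltnW lt) orbT.
  - by move: n1 n0; case: (n).
  - by rewrite up_log1 expn0 muln1 expn_gt0 (ltnW s1).
exists (m * (2 * n ^ 2))%N; split.
- by rewrite leq_pmull.
- by rewrite muln_gt0 m0 muln_gt0 expn_gt0 n0.
have M0 : (0 < 2 * n ^ 2)%N by rewrite muln_gt0 expn_gt0 n0.
apply: (le_trans (avg_largest_admissible_le R B1 Bq nm m0 M0 (MT j))).
have m1R : 1 <= m%:R :> R by rewrite ler1n.
have m0R : 0 < m%:R :> R by rewrite ltr0n.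
apply: (@le_trans _ _ (C1 * m%:R `^ (1 + 2 * e))).
  have m_neq0 : m%:R != 0 :> R by rewrite gt_eqF.
  rewrite powRD ?m_neq0 ?implybT // powRr1 // /C1 mulrDl.
  apply: lerD.
    rewrite -mulrA -[leRHS]mulrA ler_wpM2l // mulrCA ler_wpM2l // mulrC.
    exact: ln_le_powR.
  rewrite mulrC ler_wpM2l ?expR_ge0 // ler_peMr //.
  by rewrite -[leLHS](powRr0 m%:R) ler_powR // ltW.
rewrite -mulrA ler_wpM2l //.
have -> : m%:R = (m%:R ^+ 2) `^ (1 / 2) :> R.
  by rewrite -powR_mulrn // -powRrM mul1r mulfV ?powRr1 // pnatr_eq0.
have -> : s%:R = (s%:R ^+ 2) `^ (1 / 2) :> R.
  by rewrite -powR_mulrn // -powRrM mul1r mulfV ?powRr1 // pnatr_eq0.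
rewrite -!powRrM (_ : 1 / 2 * (1 + 2 * e) = 1 / 2 + e); last by field.
rewrite -powRM ?exprn_ge0 // -!natrX -natrM.
apply: ge0_ler_powR; rewrite ?nnegrE ?ler_nat //; lra.
Qed.

(** [longest_tail] with [l = n^(gamma - alpha)].  The exponent [e] is the slack
spent once on the harmonic number and once on the mean; it has to keep
[l * H] and [8 * l ^+ 2 * H * mu / n^gamma] of negative order. *)
Lemma avg_longest_tail_near (R : realType) (B : set permutation) q
    (alpha beta : R) :
  (forall q, B q -> (1 <= plength q)%N) -> B q ->
  1 / 3 < alpha -> beta < Num.min alpha (3 * alpha - 1) ->
  \forall n \near \oo,
    let L (p : 'S_n) : R := (longest (Av B) (existT _ n p))%:R in
    avg (fun p => (n%:R `^ alpha <= `|L p - avg L|)%R%:R) <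
      expR (- n%:R `^ beta).
Proof.
move=> B1 Bq a3; rewrite lt_min => /andP[ba b3a].
pose b0 := Num.max beta 0.
have /andP[b0a b03a] : (b0 < alpha) && (b0 < 3 * alpha - 1).
  by rewrite !gt_max ba b3a /=; apply/andP; split; lra.
have b0b : beta <= b0 by rewrite le_max lexx.
have b00 : 0 <= b0 by rewrite le_max lexx orbT.
have [gamma /andP[bg g_lt]] : exists g, b0 < g < Num.min alpha (3 * alpha - 1).
  exists ((b0 + Num.min alpha (3 * alpha - 1)) / 2).
  have b0m : b0 < Num.min alpha (3 * alpha - 1) by rewrite lt_min b0a.
  by have [-> ->] := midf_lt b0m.
have /andP[ga g3a] : (gamma < alpha) && (gamma < 3 * alpha - 1).
  by rewrite -lt_min.
have [e [e0 ea eb]] : exists e : R,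
    [/\ 0 < e, gamma - alpha + e < 0 & 2 * e + gamma < 2 * alpha - 1 / 2].
  exists (Num.min ((alpha - gamma) / 2) ((2 * alpha - 1 / 2 - gamma) / 4)).
  by case: (leP ((alpha - gamma) / 2) _) => ?; split; lra.
have [C [C0 hC]] := avg_largest_powR B1 Bq e0.
pose K := 1 + e^-1 : R.
have K0 : 0 <= K by rewrite addr_ge0 // invr_ge0 ltW.
have F1 : \forall n \near \oo, 6 * n%:R `^ (gamma - alpha) <= n%:R `^ 0 :> R.
  by apply: near_powR_le; lra.
have F2 : \forall n \near \oo,
    4 * K * n%:R `^ (gamma - alpha + e) <= n%:R `^ 0 :> R.
  by apply: near_powR_le; lra.
have F3 : \forall n \near \oo, 32 * (K * C) *
    n%:R `^ (gamma - alpha + (gamma - alpha) + (e + (1 / 2 + e)))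
      <= n%:R `^ gamma :> R.
  by apply: near_powR_le; lra.
have F4 : \forall n \near \oo, 4 * n%:R `^ beta <= n%:R `^ gamma :> R.
  by apply: near_powR_le; lra.
have F5 : \forall n \near \oo, 64 * n%:R `^ 0 <= n%:R `^ gamma :> R.
  by apply: near_powR_le; lra.
have F0 : \forall n \near \oo, (1 <= n)%N by exact: nbhs_infty_ge.
near=> n.
have n1 : (1 <= n)%N by near: n; exact: F0.
have f1 : 6 * n%:R `^ (gamma - alpha) <= n%:R `^ 0 :> R by near: n; exact: F1.
have f2 : 4 * K * n%:R `^ (gamma - alpha + e) <= n%:R `^ 0 :> R.
  by near: n; exact: F2.
have f3 : 32 * (K * C) *
    n%:R `^ (gamma - alpha + (gamma - alpha) + (e + (1 / 2 + e)))
      <= n%:R `^ gamma :> R by near: n; exact: F3.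
have f4 : 4 * n%:R `^ beta <= n%:R `^ gamma :> R by near: n; exact: F4.
have f5 : 64 * n%:R `^ 0 <= n%:R `^ gamma :> R by near: n; exact: F5.
pose L (p : 'S_n) : R := (longest (Av B) (existT _ n p))%:R.
change (avg (fun p => (n%:R `^ alpha <= `|L p - avg L|)%R%:R) <
  expR (- n%:R `^ beta)).
have [N [nN N0 mu_le]] := hC n n1.
set mu := (X in X <= _) in mu_le.
pose l := n%:R `^ (gamma - alpha) : R.
pose H := \sum_(j < n) j.+1%:R^-1 : R.
have nz : n%:R != 0 :> R by rewrite pnatr_eq0 -lt0n.
have pD (a b : R) : n%:R `^ (a + b) = n%:R `^ a * n%:R `^ b :> R.
  by rewrite powRD // nz implybT.
rewrite powRr0 in f1 f2 f5.
have l0 : 0 <= l by exact: powR_ge0.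
have H_le : H <= K * n%:R `^ e by exact: harmonic_sum_powR.
have H0 : 0 <= H by rewrite sumr_ge0.
have mu0 : 0 <= mu by apply: avg_ge0.
have l6 : l <= 1 / 6 by rewrite /l; lra.
have lH : 4 * l * H <= 1.
  apply: le_trans f2; rewrite pD -/l.
  have -> : 4 * K * (l * n%:R `^ e) = 4 * l * (K * n%:R `^ e) by ring.
  by rewrite ler_wpM2l // mulr_ge0.
have := longest_tail (n%:R `^ alpha) B1 nN N0 l0 l6 lH.
rewrite -/mu -/H => /le_lt_trans; apply.
have -> : l * n%:R `^ alpha = n%:R `^ gamma by rewrite -pD subrK.
have V_le : 8 * l ^+ 2 * H * mu <= n%:R `^ gamma / 4.
  rewrite ler_pdivlMr //; apply: le_trans f3.
  rewrite pD (pD (gamma - alpha)) (pD e) -/l.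
  have -> : 8 * l ^+ 2 * H * mu * 4 = 32 * l ^+ 2 * (H * mu) by ring.
  set u := n%:R `^ e in H_le *; set w := n%:R `^ (1 / 2 + e) in mu_le *.
  have -> : 32 * (K * C) * (l * l * (u * w)) =
    32 * l ^+ 2 * ((K * u) * (C * w)) by ring.
  by rewrite ler_wpM2l ?mulr_ge0 ?sqr_ge0 // ler_pM.
apply: (@lt_le_trans _ _ (expR 9 * expR (8 * l ^+ 2 * H * mu - n%:R `^ gamma))).
  (* 8 < expR 9 by 1 + u <= expR u; n^gamma >= 64 absorbs the 9 *)
  rewrite ltr_pM2r ?expR_gt0 //.
  by apply: lt_le_trans (expR_ge1Dx _); lra.
rewrite -expRD ler_expR; lra.
Unshelve. all: by end_near. Qed.

(** * The law of a uniform random permutation *)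

(** The random variable is the finite combination of the indicators of the
events [X = p]. *)
Lemma expectation_uniform_perm (R : realType) (d : measure_display)
    (T : measurableType d) (P : probability T R) n (X : T -> 'S_n)
    (h : 'S_n -> R) :
  uniform_perm P X -> ('E_P[fun t => h (X t)] = (avg h)%:E)%E.
Proof.
move=> unif; rewrite unlock.
have fE t : (h (X t))%:E = (\sum_p (h p)%:E * (\1_(X @^-1` [set p]) t)%:E)%E.
  rewrite (bigD1 (X t)) //= big1 ?adde0 => [|p pX].
    by rewrite indicE mem_set // mule1.
  by rewrite indicE memNset ?mule0 // => /esym/eqP; exact/negP.
under eq_integral do rewrite fE.
rewrite integral_sum //= => [|p]; last first.
  by apply: integrableZl => //; apply: integrable_indic; have [] := unif p.
rewrite (eq_bigr (fun p => (h p * n`!%:R^-1)%:E)) => [|p _].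
  by rewrite sumEFin -mulr_suml /avg card_Sn.
have [mp Pp] := unif p.
rewrite integralZl //; last exact: integrable_indic.
by rewrite integral_indic // setIT EFinM; congr (_ * _)%E; exact: Pp.
Qed.

Lemma probability_uniform_perm (R : realType) (d : measure_display)
    (T : measurableType d) (P : probability T R) n (X : T -> 'S_n)
    (D : pred 'S_n) :
  uniform_perm P X -> P [set t | D (X t)] = (avg (fun p => (D p)%:R))%:E.
Proof.
move=> unif; rewrite -(expectation_uniform_perm _ unif) unlock.
have mD : measurable [set t | D (X t)].
  have -> : [set t | D (X t)] =
      \bigcup_(p in [set p | D p]) (X @^-1` [set p]).
    by apply/seteqP; split=> [t Dt|t [p Dp /= ->]] //; exists (X t).
  apply: fin_bigcup_measurable => [|p _]; first exact: finite_finset.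
  by have [] := unif p.
rewrite -[X in P X]setIT -integral_indic //.
apply: eq_integral => t _; rewrite indicE.
suff -> : (t \in [set t | D (X t)]) = D (X t) by [].
by apply/idP/idP; rewrite inE.
Qed.

Unset Implicit Arguments.

Theorem theorem3 (R : realType) (A : set permutation)
  (A_class : avoidance_class A) (A_proper : A <> setT)
  (d : nat -> measure_display) (T : forall n : nat, measurableType (d n))
  (P : forall n : nat, probability (T n) R)
  (Pi : forall n : nat, T n -> 'S_n)
  (Pi_uniform : forall n : nat, uniform_perm (P n) (Pi n))
  (alpha beta : R) (h_alpha : 1 / 3 < alpha)
  (h_beta : beta < Num.min alpha (3 * alpha - 1)) :
  let L (n : nat) (t : T n) : R := (longest A (existT _ n (Pi n t)))%:R in
  \forall n \near \oo,
    (P n [set t | (n%:R `^ alpha)%:E <= `|(L n t)%:E - 'E_(P n)[L n]|]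
       < (expR (- n%:R `^ beta))%:E)%E.
Proof.
have [B B1 AB] := A_class.
have [q Bq] : exists q, B q.
  apply: contrapT => noB; apply: A_proper; rewrite AB; apply/seteqP.
  by split=> // p _ q Bq; case: noB; exists q.
move=> L; have := avg_longest_tail_near B1 Bq h_alpha h_beta.
apply: filterS => n /= tail.
pose h (p : 'S_n) : R := (longest A (existT _ n p))%:R.
have -> : ('E_(P n)[L n] = (avg h)%:E)%E.
  exact: (expectation_uniform_perm h (Pi_uniform n)).
have -> : [set t | ((n%:R `^ alpha)%:E <= `|(L n t)%:E - (avg h)%:E|)%E] =
    [set t | n%:R `^ alpha <= `|h (Pi n t) - avg h|].
  by apply/funext => t /=; rewrite lee_fin.
rewrite (probability_uniform_perm (fun p => n%:R `^ alpha <= `|h p - avg h|)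
  (Pi_uniform n)) lte_fin.
by rewrite /h AB.
Qed.
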